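(* Let $p$ be a prime number and let $0\neq f(t)=\sum_{0\le i\le l}a_it^{d-i}\in\mathbb{C}_p[t^{\pm1}]$ with $d\in\mathbb{Z}$ and $l\in\mathbb{Z}_{\ge0}$. Then $$M_p(f(t))=\max\{|a_i|_p : 0\le i\le l\}.$$ In other words, the $p$-adic Mahler measure of $f(t)$ coincides with the Gauss norm of $f(t)$.
   Context: $\mathbb{C}_p$ is the $p$-adic completion of an algebraic closure of $\mathbb{Q}_p$, with $p$-adic absolute value $|\cdot|_p$ normalized by $|p|_p=p^{-1}$. The $p$-adic Mahler measure of $0\ne f(t)\in\mathbb{C}_p[t^{\pm1}]$ (which may have roots on $|z|_p=1$) is defined by $$\log M_p(f(t))=\lim_{n\to\infty}\frac1n\sum_{\zeta^n=1,\ f(\zeta)\ne0}\log|f(\zeta)|_p,$$ where $n$ runs over positive integers, $\zeta$ over $n$-th roots of unity in $\mathbb{C}_p$ with $f(\zeta)\neq 0$, and the limit is in the Euclidean topology. *)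

(* Defs.v *)
From HB Require Import structures.
From mathcomp Require Import all_boot all_order all_algebra finmap.
From mathcomp Require Import all_classical all_reals all_analysis.
(* The notations of monalg clash with those of mathcomp-analysis. *)
From mathcomp Require Import -(notations) monalg.

Set Implicit Arguments.
Unset Strict Implicit.
Unset Printing Implicit Defensive.

Import Order.TTheory GRing.Theory Num.Theory.
Import numFieldNormedType.Exports.

Local Open Scope classical_set_scope.
Local Open Scope ring_scope.

Definition padic_abs (R : realType) (p : nat) (x : rat) : R :=
  if x == 0 then 0
  else p%:R ^ ((logn p `|denq x|%N)%:Z - (logn p `|numq x|%N)%:Z).

Record nonarch_absval (R : realType) (F : fieldType) (v : F -> R) : Prop :=
  NonarchAbsval {
    absval_ge0 : forall x, 0 <= v x;
    absval_eq0 : forall x, v x = 0 <-> x = 0;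
    absvalM : forall x y, v (x * y) = v x * v y;
    absvalD : forall x y, v (x + y) <= Num.max (v x) (v y)
  }.

Definition absval_complete (R : realType) (F : fieldType) (v : F -> R) : Prop :=
  forall u : nat -> F,
    (forall e : R, 0 < e -> exists N : nat, forall m n : nat,
       (N <= m)%N -> (N <= n)%N -> v (u m - u n) < e) ->
    exists x : F, (fun n => v (u n - x)) @ \oo --> (0 : R).

Record is_completion (R : realType) (F F' : fieldType)
    (v : F -> R) (v' : F' -> R) (iota : {rmorphism F -> F'}) : Prop :=
  IsCompletion {
    completion_absval : nonarch_absval v';
    completion_isometry : forall x, v' (iota x) = v x;
    completion_dense : forall (x : F') (e : R), 0 < e ->
      exists y : F, v' (x - iota y) < e;
    completion_complete : absval_complete v'
  }.

Definition is_algebraic_closure (F E : fieldType) (iota : {rmorphism F -> E}) :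
    Prop :=
  (forall x : E, algebraicOver iota x) /\ GRing.closed_field_axiom E.

(* Each of the fields Q_p, its algebraic closure and C_p is determined only up
   to isomorphism, so a C_p is any field obtained by the usual three steps:
   Q -> Qp (p-adic completion), Qp -> Qpbar (algebraic closure, with an absolute
   value extending that of Qp; there is only one), Qpbar -> Cp (completion).
   That Cp is itself algebraically closed is a theorem, not part of the data. *)
Record padic_complex (R : realType) (p : nat) := PadicComplex {
  Qp : fieldType;
  Qp_abs : Qp -> R;
  Qp_of_rat : {rmorphism rat -> Qp};
  Qp_completion : is_completion (padic_abs R p) Qp_abs Qp_of_rat;
  Qpbar : fieldType;
  Qpbar_abs : Qpbar -> R;
  Qpbar_of_Qp : {rmorphism Qp -> Qpbar};
  Qpbar_closure : is_algebraic_closure Qpbar_of_Qp;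
  Qpbar_absval : nonarch_absval Qpbar_abs;
  Qpbar_abs_extends : forall x, Qpbar_abs (Qpbar_of_Qp x) = Qp_abs x;
  Cp :> fieldType;
  Cp_abs : Cp -> R;
  Cp_of_Qpbar : {rmorphism Qpbar -> Cp};
  Cp_completion : is_completion Qpbar_abs Cp_abs Cp_of_Qpbar
}.

(* Finitely supported functions int -> K; only the additive structure is
   provided, since monalg's product excludes invertible monomials. *)
Notation laurent K := (malg int K) (only parsing).

Definition laurent_monomial (K : fieldType) (c : K) (k : int) : laurent K :=
  mkmalgU k c.

Definition laurent_eval (K : fieldType) (f : laurent K) (z : K) : K :=
  mmap idfun (fun k : int => z ^ k) f.

Definition gauss_norm (R : realType) (K : fieldType) (v : K -> R)
    (f : laurent K) : R :=
  \big[Num.max/0]_(k <- msupp f) v (mcoeff k f).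

(* The value at n = 0, where the index set may be infinite, is 0 because
   0^-1 = 0; it plays no role in the limit. *)
Definition log_mahler_mean (R : realType) (K : fieldType) (v : K -> R)
    (f : laurent K) (n : nat) : R :=
  n%:R^-1 * \sum_(z \in [set z : K | z ^+ n = 1 /\ laurent_eval f z <> 0])
              ln (v (laurent_eval f z)).

(* Meaningful only if the sequence converges: lim is a total function. *)
Definition mahler_measure (R : realType) (K : fieldType) (v : K -> R)
    (f : laurent K) : R :=
  expR (lim (log_mahler_mean v f @ \oo)).

(* Main.v *)
(** After normalising, the Gauss norm [G] of [f] bounds [|f(z)|] for every root
    of unity [z], so it suffices to see that for [r < 1] only finitely many
    roots of unity satisfy [|f(z)| <= r G]: the others contribute between
    [ln r] and [0] to the mean of [ln (|f(z)| / G)], and the exceptional ones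
    contribute [O(1/n)].

    For finiteness, divided differences show that a polynomial of size [k] that
    is at most [r G] at [k] points of the unit disc with pairwise distances at
    least [s] has Gauss norm at most [r G / s ^ k], which is absurd for [s]
    close to 1. So the exceptional set is covered by fewer than [k] discs of
    radius [s < 1], and such a disc contains only finitely many roots of unity. *)
Require Import Defs.
From HB Require Import structures.
From mathcomp Require Import all_boot all_order all_algebra.
From mathcomp Require Import all_classical all_reals all_analysis.
From mathcomp Require Import -(notations) monalg.
From mathcomp Require Import finmap separable cyclotomic closed_field.
From mathcomp Require Import ring lra.

Set Implicit Arguments.
Unset Strict Implicit.
Unset Printing Implicit Defensive.

Import Order.TTheory GRing.Theory Num.Theory.
Import numFieldNormedType.Exports.

Local Open Scope classical_set_scope.
Local Open Scope ring_scope.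

Lemma finite_set_root (F : idomainType) (P : {poly F}) : P != 0 ->
  finite_set [set x | root P x].
Proof.
move=> P0; apply: contrapT => /(infinite_set_fset (size P))[B BP].
apply/negP; rewrite -ltnNge; apply: max_poly_roots => //.
  by apply/allP => x /BP.
exact: fset_uniq.
Qed.

(** * Non-archimedean absolute values *)

Section Absval.
Variables (R : realType) (F : fieldType) (v : F -> R).
Hypothesis vP : nonarch_absval v.

Lemma absval_0 : v 0 = 0.
Proof. by apply/(absval_eq0 vP). Qed.

Lemma absval_gt0 x : x != 0 -> 0 < v x.
Proof.
move=> x0; rewrite lt_neqAle (absval_ge0 vP) andbT eq_sym.
by apply: contra x0 => /eqP/(absval_eq0 vP)/eqP.
Qed.

Lemma absval_1 : v 1 = 1.
Proof.
have v1 : v 1 != 0 by rewrite gt_eqF ?absval_gt0 ?oner_neq0.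
by apply: (mulfI v1); rewrite -(absvalM vP) !mulr1.
Qed.

Lemma absval_X x n : v (x ^+ n) = v x ^+ n.
Proof.
by elim: n => [|n IHn]; rewrite ?expr0 ?absval_1 // !exprS (absvalM vP) IHn.
Qed.

Lemma absval_unity_root n z : (0 < n)%N -> z ^+ n = 1 -> v z = 1.
Proof.
move=> n0 zn; apply/eqP; rewrite -(pexpr_eq1 n0) ?(absval_ge0 vP) //.
by rewrite -absval_X zn absval_1.
Qed.

Lemma absval_eq1_neq0 x : v x = 1 -> x != 0.
Proof.
by move=> x1; apply/eqP => x0; move/eqP: x1; rewrite x0 absval_0 eq_sym oner_eq0.
Qed.

Lemma absval_N x : v (- x) = v x.
Proof.
rewrite -mulN1r (absvalM vP) (@absval_unity_root 2) ?mul1r //.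
by rewrite expr2 mulrNN mulr1.
Qed.

Lemma absval_V x : x != 0 -> v x^-1 = (v x)^-1.
Proof.
move=> x0; have vx0 : v x != 0 by rewrite gt_eqF ?absval_gt0.
by apply: (mulfI vx0); rewrite -(absvalM vP) !divff // absval_1.
Qed.

Lemma absval_D_le B x y : v x <= B -> v y <= B -> v (x + y) <= B.
Proof. by move=> xB yB; rewrite (le_trans (absvalD vP x y))// ge_max xB. Qed.

Lemma absval_B_le B x y : v x <= B -> v y <= B -> v (x - y) <= B.
Proof. by move=> xB yB; apply: absval_D_le; rewrite ?absval_N. Qed.

Lemma absval_sum_le (I : Type) (r : seq I) (P : pred I) (E : I -> F) B :
  0 <= B -> (forall i, P i -> v (E i) <= B) -> v (\sum_(i <- r | P i) E i) <= B.
Proof.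
move=> B0 EB; apply: (big_ind (fun x => v x <= B)) => //.
  by rewrite absval_0.
by move=> x y; exact: absval_D_le.
Qed.

(** * Roots of unity close to 1 *)

Lemma absval_subX1_le n z : v z = 1 -> v (z ^+ n - 1) <= v (z - 1).
Proof.
move=> z1; rewrite subrX1 (absvalM vP) ler_piMr ?(absval_ge0 vP) //.
by apply: absval_sum_le => // i _; rewrite absval_X z1 expr1n.
Qed.

Lemma absval_sub_geom_sum_le n z : v z = 1 ->
  v (\sum_(i < n) z ^+ i - n%:R) <= v (z - 1).
Proof.
move=> z1; have -> : n%:R = \sum_(i < n) 1 :> F by rewrite sumr_const card_ord.
rewrite -sumrB; apply: absval_sum_le => [|i _]; first exact: (absval_ge0 vP).
exact: absval_subX1_le.
Qed.

(** As [z] is not 1, the sum of [z ^+ i] for [i < q] vanishes; each term is within [v (z - 1)] of 1,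
    so 0 is within [v (z - 1)] of [q]. *)
Lemma absval_unity_root_prime q z : (0 < q)%N -> z ^+ q = 1 -> z != 1 ->
  v q%:R <= v (z - 1).
Proof.
move=> q0 zq z1; have /eqP := subrX1 z q.
rewrite zq subrr eq_sym mulf_eq0 subr_eq0 (negbTE z1) /= => /eqP s0.
have := @absval_sub_geom_sum_le q z (absval_unity_root q0 zq).
by rewrite s0 sub0r absval_N.
Qed.

(** Strong induction on the exponent. For a prime factor [q] of [n], the power [w = z ^+ (n / q)]
    satisfies [w ^+ q = 1]; if [w] were not 1, then [d <= v q%:R <= v (w - 1) <= v (z - 1)]. So
    [w = 1], and [n / q] is a smaller exponent for [z]. *)
Lemma unity_root_close_eq1 d n z :
  (forall q, prime q -> d <= v q%:R) ->
  (0 < n)%N -> z ^+ n = 1 -> v (z - 1) < d -> z = 1.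
Proof.
move=> dP; elim/ltn_ind: n => n IHn n0 zn zd.
have [n1|n1] := leqP n 1.
  by move: zn; rewrite (_ : n = 1%N) ?expr1 //; apply/eqP; rewrite eqn_leq n1.
have q_pr := pdiv_prime n1; have q_dv := pdiv_dvd n.
have m0 : (0 < n %/ pdiv n)%N by rewrite divn_gt0 ?pdiv_gt0 // dvdn_leq.
apply: (IHn (n %/ pdiv n)%N) => //; first by rewrite ltn_Pdiv ?prime_gt1.
apply/eqP; apply: contraTT zd => w1; rewrite -leNgt.
apply: le_trans (absval_subX1_le (n %/ pdiv n) (absval_unity_root n0 zn)).
apply: le_trans (dP _ q_pr) _; apply: absval_unity_root_prime => //.
by rewrite -exprM divnK.
Qed.

(* Raising to the power [p] contracts the disc [v (z - 1) <= s], hence a fixed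
   number of steps brings all its roots of unity close enough to 1. *)
Lemma unity_root_disc_exponent d s p : 0 < d ->
  (forall q, prime q -> d <= v q%:R) -> (0 < p)%N -> v p%:R < 1 -> s < 1 ->
  exists2 N, (0 < N)%N & forall n z, (0 < n)%N -> z ^+ n = 1 ->
    v (z - 1) <= s -> z ^+ N = 1.
Proof.
move=> d0 dP p0 vp s1; pose c := Num.max (v p%:R) s.
have c0 : 0 <= c by rewrite le_max (absval_ge0 vP).
have c1 : c < 1 by rewrite gt_max vp.
have [k ckd] : exists k, c ^+ k < d.
  have cn : `|c| < 1 by rewrite ger0_norm.
  have [k _ /(_ k (leqnn k))] := (cvgr0Pnorm_lt _).1 (cvg_expr cn) _ d0.
  by rewrite /= normrX (ger0_norm c0) => ckd; exists k.
exists (p ^ k)%N => [|n z n0 zn zs]; first by rewrite expn_gt0 p0.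
have contr j : v (z ^+ (p ^ j) - 1) <= c ^+ j.+1.
  elim: j => [|j IHj]; first by rewrite expn0 !expr1 le_max zs orbT.
  have w1 : v (z ^+ (p ^ j)) = 1.
    by rewrite absval_X (absval_unity_root n0 zn) expr1n.
  (* For [w = z ^+ (p ^ j)], [w ^+ p - 1] is [w - 1] times a geometric sum. That sum is within
     [v (w - 1) <= c] of [p], so its absolute value is at most [c]. *)
  rewrite expnSr exprM subrX1 (absvalM vP) exprSr.
  apply: ler_pM; rewrite ?(absval_ge0 vP) //.
  rewrite -[X in v X](subrK p%:R); apply: absval_D_le.
    apply: le_trans (absval_sub_geom_sum_le p w1) _; apply: le_trans IHj _.
    by rewrite -[leRHS]expr1 ler_wiXn2l // ltW.
  by rewrite le_max lexx.
apply: (@unity_root_close_eq1 d n) => //; first by rewrite exprAC zn expr1n.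
apply: le_lt_trans ckd; apply: le_trans (contr k) _.
by rewrite ler_wiXn2l // ltW.
Qed.

(** * Separated points and finiteness of the exceptional set *)

(* Divided differences: [P = P(x0) + ('X - x0) Q], where [Q] has smaller degree
   and is bounded by [B / s] at the remaining points. *)
Lemma coef_le_of_separated_values s B (P : {poly F}) (xs : seq F) :
  0 < s <= 1 -> 0 <= B -> (size P <= size xs)%N ->
  (forall x, x \in xs -> v x <= 1 /\ v P.[x] <= B) ->
  pairwise (fun x y => s <= v (x - y)) xs ->
  forall i, v P`_i <= B / s ^+ (size xs).
Proof.
move=> /andP[s0 s1]; elim: xs P B => [|x xs IHxs] P B B0 /=.
  rewrite leqn0 size_poly_eq0 => /eqP -> _ _ i.
  by rewrite coef0 absval_0 expr0 divr1.
move=> sP vals /andP[/allP sepx sep] i.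
have [x1 Px] := vals x (mem_head _ _).
have /factor_theorem[Q PQ] : root (P - P.[x]%:P) x.
  by rewrite /root !hornerE subrr.
have BB : B <= B / s by rewrite ler_pdivlMr // ler_piMr.
have BBB : B <= B / s ^+ (size xs).+1.
  by rewrite ler_pdivlMr ?exprn_gt0 // ler_piMr // exprn_ile1 // ltW.
have sQ : (size Q <= size xs)%N.
  have [->|Q0] := eqVneq Q 0; first by rewrite size_poly0.
  have : (size (Q * ('X - x%:P))%R <= (size xs).+1)%N.
    rewrite -PQ (leq_trans (size_polyD _ _)) // geq_max sP size_polyN.
    by rewrite (leq_trans (size_polyC_leq1 _)).
  by rewrite size_Mmonic ?monicXsubC // size_XsubC addn2.
have Qc j : v Q`_j <= B / s ^+ (size xs).+1.
  rewrite exprS invfM mulrA.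
  apply: IHxs => //; first by rewrite divr_ge0 // ltW.
  move=> y yxs; have [y1 Py] := vals y (mem_behead (s := x :: xs) yxs).
  split=> //; have := congr1 (fun q => v q.[y]) PQ.
  rewrite !hornerE /= (absvalM vP) => PQy.
  rewrite ler_pdivlMr //; apply: le_trans (absval_B_le Py Px).
  rewrite PQy ler_wpM2l ?(absval_ge0 vP) //.
  by rewrite -absval_N opprB; exact: sepx.
have /(congr1 (fun q : {poly F} => q`_i)) : P = Q * ('X - x%:P) + P.[x]%:P.
  by rewrite -PQ subrK.
move=> ->; rewrite coefD coefC; apply: absval_D_le; last first.
  by case: ifP => _; rewrite ?absval_0 ?(le_trans Px) // (le_trans B0).
rewrite mulrBr coefB coefMX coefMC; apply: absval_B_le.
  by case: ifP => _ //; rewrite absval_0 (le_trans B0).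
by rewrite (absvalM vP) (le_trans _ (Qc i)) // ler_piMr ?(absval_ge0 vP).
Qed.

(** Greedy choice: the discs around finitely many chosen points contain only finitely many points of
    [S], so an infinite [S] always has a further point at distance at least [s] from all of them. *)
Lemma finite_set_of_no_separated_seq (S : set F) s n :
  (forall x, S x -> finite_set [set y | S y /\ v (x - y) < s]) ->
  (forall xs : seq F, size xs = n -> (forall x, x \in xs -> S x) ->
     ~ pairwise (fun x y => s <= v (x - y)) xs) ->
  finite_set S.
Proof.
move=> ballS nosep; apply: contrapT => infS.
suff [xs [sz xsS sep]] : exists xs : seq F, [/\ size xs = n,
    forall x, x \in xs -> S x & pairwise (fun x y => s <= v (x - y)) xs].
  exact: nosep sep.
elim: n {nosep} => [|n [xs [sz xsS sep]]]; first by exists [::].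
have [y [Sy yP]] : exists y, S y /\ forall x, x \in xs -> s <= v (x - y).
  apply: contrapT => /forallNP noy; apply: infS.
  apply: (@sub_finite_set _ _
    (\bigcup_(x in [set` xs]) [set y | S y /\ v (x - y) < s])).
    move=> y Sy; apply: contrapT => ny; apply: (noy y); split=> // x xxs.
    by rewrite leNgt; apply/negP => xy; apply: ny; exists x.
  by apply: bigcup_finite => // x /= xxs; apply: ballS; exact: xsS.
exists (y :: xs); split => /=; first by rewrite sz.
  by move=> x; rewrite inE => /orP[/eqP ->|/xsS].
rewrite sep andbT; apply/allP => x /yP.
by rewrite -[v (x - y)]absval_N opprB.
Qed.

Lemma absval_horner_le (P : {poly F}) G z : 0 <= G -> (forall i, v P`_i <= G) ->
  v z = 1 -> v P.[z] <= G.
Proof.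
move=> G0 PG z1; rewrite horner_coef; apply: absval_sum_le => // i _.
by rewrite (absvalM vP) absval_X z1 expr1n mulr1.
Qed.

(** Division by the centre [x] moves the disc to 1, where one exponent [N] kills every root of
    unity. Hence [y ^+ N = x ^+ N], an equation with finitely many solutions. *)
Lemma finite_unity_root_disc d s p x : 0 < d ->
  (forall q, prime q -> d <= v q%:R) -> (0 < p)%N -> v p%:R < 1 -> s < 1 ->
  (exists2 n, (0 < n)%N & x ^+ n = 1) ->
  finite_set [set y | (exists2 n, (0 < n)%N & y ^+ n = 1) /\ v (x - y) < s].
Proof.
move=> d0 dP p0 vp s1 [m m0 xm].
have [N N0 NP] := unity_root_disc_exponent d0 dP p0 vp s1.
have vx := absval_unity_root m0 xm.
have x0 := absval_eq1_neq0 vx.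
have XN0 : 'X^N - (x ^+ N)%:P != 0 :> {poly F}.
  by rewrite -size_poly_eq0 size_XnsubC.
suff : [set y | (exists2 n, (0 < n)%N & y ^+ n = 1) /\ v (x - y) < s] `<=`
    [set y | root ('X^N - (x ^+ N)%:P) y].
  move/sub_finite_set; apply.
  exact: finite_set_root.
move=> y [[n n0 yn] xy] /=.
have yx1 : (y / x) ^+ (n * m) = 1.
  by rewrite exprMn exprVn exprM yn expr1n mulnC exprM xm expr1n invr1 mulr1.
have := NP (n * m)%N (y / x) _ yx1; rewrite muln_gt0 n0 m0 => /(_ isT).
have -> : y / x - 1 = - (x - y) / x by rewrite mulNr mulrBl divff // opprB.
rewrite (absvalM vP) absval_N absval_V // vx invr1 mulr1 => /(_ (ltW xy)).
rewrite exprMn exprVn => /(canRL (mulfVK (expf_neq0 N x0))).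
by rewrite mul1r /root !hornerE => ->; rewrite subrr.
Qed.

Lemma finite_unity_root_small_value d p (P : {poly F}) G e : 0 < d ->
  (forall q, prime q -> d <= v q%:R) -> (0 < p)%N -> v p%:R < 1 ->
  0 < G -> (exists i, v P`_i = G) -> 0 < e ->
  finite_set
    [set z | (exists2 n, (0 < n)%N & z ^+ n = 1) /\ v P.[z] <= expR (- e) * G].
Proof.
move=> d0 dP p0 vp G0 [i0 Pi0] e0.
(* The successor in the denominator makes [s ^+ size P], which is
   [expR (- e * size P / (size P + 1))], strictly larger than [expR (- e)]. *)
pose t := e / (size P).+1%:R; pose s := expR (- t).
have t0 : 0 < t by rewrite divr_gt0.
have s0 : 0 < s by exact: expR_gt0.
have s1 : s < 1 by rewrite -expR0 ltr_expR oppr_lt0.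
have rs : expR (- e) < s ^+ size P.
  rewrite -expRM_natl ltr_expR mulrN ltrN2 /t mulrA ltr_pdivrMr //.
  by rewrite mulrC ltr_pM2l // ltr_nat.
apply: (@finite_set_of_no_separated_seq _ s (size P)).
  move=> x [xU _].
  apply: sub_finite_set (finite_unity_root_disc d0 dP p0 vp s1 xU).
  by move=> y [[yU _] xy].
move=> xs sz xsS sep.
have rG : 0 <= expR (- e) * G by rewrite mulr_ge0 ?expR_ge0 ?ltW.
(* At the index where the coefficient attains [G], this bound gives [s ^+ size P <= expR (- e)],
   against [rs]. *)
have : v P`_i0 <= expR (- e) * G / s ^+ size P.
  rewrite -sz; apply: coef_le_of_separated_values; rewrite ?s0 ?(ltW s1) ?sz //.
  move=> x /xsS [[n n0 xn] Px]; split=> //.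
  by rewrite (absval_unity_root n0 xn).
rewrite Pi0 ler_pdivlMr ?exprn_gt0 // mulrC ler_pM2r // leNgt => /negP; exact.
Qed.
End Absval.

(** * Roots of unity in algebraically closed fields *)

Lemma closed_field_monic_split (E : fieldType) (P : {poly E}) :
  GRing.closed_field_axiom E -> P \is monic ->
  exists r : seq E, P = \prod_(z <- r) ('X - z%:P).
Proof.
move=> Eclosed; move: {2}(size P) (leqnn (size P)) => n.
elim: n P => [|n IHn] P.
  by rewrite leqn0 size_poly_eq0 => /eqP -> /monic_neq0; rewrite eqxx.
move=> sP monP.
have [sP1|/(PreClosedField.closed_rootP Eclosed)[x]] := eqVneq (size P) 1.
  exists [::]; rewrite big_nil; move: monP.
  by rewrite (size1_polyC (eq_leq sP1)) monicE lead_coefC => /eqP ->.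
move=> /factor_theorem[Q PQ].
have monQ : Q \is monic by rewrite -(monicMr _ (monicXsubC x)) -PQ.
have [|r Qr] := IHn Q _ monQ; last first.
  by exists (rcons r x); rewrite big_rcons /= PQ Qr.
by move: sP; rewrite PQ size_Mmonic ?monic_neq0 ?monicXsubC // size_XsubC addn2.
Qed.

(** As [n] is nonzero in [E], ['X^n - 1] is separable, so its [n] linear factors have distinct
    roots. *)
Lemma closed_field_unity_roots (E : fieldType) n :
  GRing.closed_field_axiom E -> n%:R != 0 :> E ->
  exists r : seq E, [/\ uniq r, size r = n & all n.-unity_root r].
Proof.
move=> Eclosed n0; have n_gt0 : (0 < n)%N by case: n n0; rewrite ?eqxx.
have [r Dp] := closed_field_monic_split Eclosed (monicXnsubC 1 n_gt0).
exists r; split.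
- by rewrite -separable_prod_XsubC -Dp separable_Xn_sub_1.
- by apply: succn_inj; rewrite -(size_prod_XsubC _ id) -Dp size_XnsubC.
- by apply/allP => z; rewrite /root_of_unity -root_prod_XsubC -Dp.
Qed.

(** * Convergence of the logarithmic means *)

Lemma ler_sum_uniq_mem (R : numDomainType) (T : eqType) (r s : seq T)
  (g : T -> R) : uniq r -> uniq s -> (forall x, 0 <= g x) ->
  \sum_(x <- r | x \in s) g x <= \sum_(x <- s) g x.
Proof.
move=> ur us g0; rewrite -big_filter.
rewrite (perm_big [seq x <- s | x \in r]) /=; last first.
  by apply: uniq_perm; rewrite ?filter_uniq // => x; rewrite !mem_filter andbC.
rewrite big_filter [leLHS]big_mkcond /=.
by apply: ler_sum => x _; case: ifP.
Qed.

(** Roots of unity at which [f] vanishes can be put back into the sum, since [ln 0 = 0] by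
    convention. *)
Lemma log_mahler_meanE (R : realType) (K : fieldType) (v : K -> R)
  (f : laurent K) n (r : seq K) : nonarch_absval v -> (0 < n)%N ->
  uniq r -> size r = n -> all n.-unity_root r ->
  log_mahler_mean v f n = n%:R^-1 * \sum_(z <- r) ln (v (laurent_eval f z)).
Proof.
move=> vP n0 ur sr rr; congr (_ * _); rewrite [RHS]fsbig_seq //.
have rE := mem_unity_roots n0 rr ur sr.
apply: fsbig_widen => [z /= [zn _]|z /= [zr nz]].
  by rewrite -rE; apply/unity_rootP.
rewrite (_ : laurent_eval f z = 0) ?(absval_0 vP) ?ln0 //.
apply: contrapT => fz; apply: nz; split=> //.
by move: zr; rewrite -rE => /unity_rootP.
Qed.

(** The polynomial [P] replaces [f], as both have the same absolute value at roots of unity. A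
    tolerance [e] is split in two: one half for the roots of unity with large value, one half for
    the finite exceptional set [X]. *)
Lemma log_mahler_mean_cvg (R : realType) (K : fieldType) (v : K -> R) d p
    (f : laurent K) (P : {poly K}) G : nonarch_absval v -> 0 < d ->
  (forall q, prime q -> d <= v q%:R) -> (0 < p)%N -> v p%:R < 1 ->
  (forall n, (0 < n)%N ->
    exists r : seq K, [/\ uniq r, size r = n & all n.-unity_root r]) ->
  (forall n z, (0 < n)%N -> z ^+ n = 1 -> v (laurent_eval f z) = v P.[z]) ->
  0 < G -> (forall i, v P`_i <= G) -> (exists i, v P`_i = G) ->
  log_mahler_mean v f @ \oo --> ln G.
Proof.
move=> vP d0 dP p0 vp rootsK fP G0 PG PGi; apply: (cvgrPdist_le _ _).2 => e e0.
have e20 : 0 < e / 2 by rewrite divr_gt0.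
have /finite_fsetP[X SX] :=
  finite_unity_root_small_value vP d0 dP p0 vp G0 PGi e20.
pose g z := `|ln G - ln (v P.[z])|.
(* The total deviation over [X] does not depend on [n], so it is at most [n * (e / 2)] for large
   [n]. At a zero of [P], [g] is still a real number because [ln 0 = 0]. *)
pose C := \sum_(z <- X) g z.
near=> n.
have n0 : (0 < n)%N by near: n; exact: nbhs_infty_gt.
have Cn : C / (e / 2) <= n%:R by near: n; exact: nbhs_infty_ger.
have nR : 0 < n%:R :> R by rewrite ltr0n.
have [r [ur sr rr]] := rootsK n n0.
rewrite (log_mahler_meanE f vP n0 ur sr rr).
have sumE :
    \sum_(z <- r) ln (v (laurent_eval f z)) = \sum_(z <- r) ln (v P.[z]).
  apply: eq_big_seq => z zr; congr ln; apply: (fP n) => //.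
  by apply/unity_rootP; exact: (allP rr).
have -> : ln G = n%:R^-1 * \sum_(z <- r) ln G.
  by rewrite big_const_seq count_predT sr iter_addr_0 -[X in _ * X]mulr_natl
    mulKf ?gt_eqF.
rewrite sumE -mulrBr -sumrB normrM gtr0_norm ?invr_gt0 //.
rewrite ler_pdivrMl //; apply: le_trans (ler_norm_sum _ _ _) _.
(* Outside [X] the value lies between [expR (- (e / 2)) * G] and [G], so its logarithm is within
   [e / 2] of [ln G]. *)
apply: (@le_trans _ _ (\sum_(z <- r) (e / 2 + if z \in X then g z else 0))).
  rewrite !big_seq; apply: ler_sum => z zr; rewrite -/(g z).
  case: ifPn => [_|zX]; first by rewrite lerDr ltW.
  have zn : z ^+ n = 1 by apply/unity_rootP; exact: (allP rr).
  have zbig : expR (- (e / 2)) * G < v P.[z].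
    rewrite ltNge; apply: contra zX => zsmall.
    have : [set` X] z by rewrite -SX; split=> //; exists n.
    by [].
  have zG : v P.[z] <= G.
    by apply: absval_horner_le => //; rewrite ?ltW // (absval_unity_root vP n0).
  have vz0 : 0 < v P.[z] by rewrite (lt_trans _ zbig) // mulr_gt0 ?expR_gt0.
  have l1 : ln (v P.[z]) <= ln G by rewrite ler_ln ?posrE.
  have l2 : - (e / 2) + ln G <= ln (v P.[z]).
    by rewrite -[X in X + _]expRK -lnM ?posrE ?expR_gt0 // ler_ln ?posrE ?ltW //
      mulr_gt0 ?expR_gt0.
  rewrite /g ger0_norm; lra.
rewrite big_split /= big_const_seq count_predT sr iter_addr_0 -big_mkcond.
(* The [n]-th roots of unity in [r] are distinct, so those lying in [X] contribute at most [C]. *)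
have := @ler_sum_uniq_mem R K r X g ur (fset_uniq X) (fun=> normr_ge0 _).
rewrite ler_pdivrMr // -/C in Cn * => H.
rewrite -[_ *+ n]mulr_natl; lra.
Unshelve. all: by end_near.
Qed.

(** * Integers and roots of unity in the p-adic complex numbers *)

Lemma padic_abs_nat (R : realType) p n : (0 < n)%N ->
  padic_abs R p n%:R = p%:R ^- logn p n.
Proof.
move=> n0; rewrite /padic_abs pnatr_eq0 gtn_eqF //.
by rewrite (pmulrn 1 n) numq_int denq_int /= logn1 sub0r -exprnN.
Qed.

Lemma Cp_abs_nat (R : realType) p (C : padic_complex R p) n :
  Cp_abs (n%:R : C) = padic_abs R p n%:R.
Proof.
rewrite -(completion_isometry (Qp_completion C)) rmorph_nat.
rewrite -Qpbar_abs_extends rmorph_nat.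
by rewrite -(completion_isometry (Cp_completion C)) rmorph_nat.
Qed.

(** The roots are found in the algebraically closed field [Qpbar C] and carried over by its
    injective embedding. *)
Lemma Cp_unity_roots (R : realType) p (C : padic_complex R p) n : (0 < n)%N ->
  exists r : seq C, [/\ uniq r, size r = n & all n.-unity_root r].
Proof.
move=> n0; have nQ : n%:R != 0 :> Qpbar C.
  rewrite -(rmorph_nat (Qpbar_of_Qp C)) fmorph_eq0.
  by rewrite -(rmorph_nat (Qp_of_rat C)) fmorph_eq0 pnatr_eq0 -lt0n.
have [r [ur sr rr]] := closed_field_unity_roots (Qpbar_closure C).2 nQ.
exists (map (Cp_of_Qpbar C) r); split.
- by rewrite map_inj_uniq //; exact: fmorph_inj.
- by rewrite size_map.
- rewrite all_map; apply: sub_all rr => z /unity_rootP zn /=.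
  by apply/unity_rootP; rewrite -rmorphXn zn rmorph1.
Qed.

(** * Laurent polynomials and their Gauss norm *)

Lemma absval_exprz1 (R : realType) (F : fieldType) (v : F -> R) z (k : int) :
  nonarch_absval v -> v z = 1 -> v (z ^ k) = 1.
Proof.
move=> vP z1; case: k => k; first by rewrite -exprnP absval_X // z1 expr1n.
rewrite NegzE -exprnN absval_V ?expf_neq0 ?(absval_eq1_neq0 vP) //.
by rewrite absval_X // z1 expr1n invr1.
Qed.

Section LaurentSum.
Variables (R : realType) (F : fieldType) (v : F -> R).
Hypothesis vP : nonarch_absval v.
Variables (d : int) (l : nat) (a : 'I_l.+1 -> F).

Let f : laurent F := \sum_(i < l.+1) laurent_monomial (a i) (d - (i : nat)%:Z).
Let G := \big[Num.max/0]_(i < l.+1) v (a i).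

Lemma mcoeff_laurent_sum k :
  mcoeff k f = \sum_(i < l.+1) a i *+ (d - (i : nat)%:Z == k).
Proof. by rewrite raddf_sum; apply: eq_bigr => i _; rewrite /= mcoeffU. Qed.

Lemma gauss_norm_laurent_sum : gauss_norm v f = G.
Proof.
have G0 : 0 <= G by apply: bigmax_ge_id.
apply/eqP; rewrite eq_le; apply/andP; split.
  rewrite /gauss_norm big_seq; apply: bigmax_le => // k _.
  rewrite mcoeff_laurent_sum; apply: absval_sum_le => // i _.
  by case: eqP => _; rewrite ?mulr1n ?mulr0n ?absval_0 //; exact: le_bigmax.
have ff0 : 0 <= gauss_norm v f by apply: bigmax_ge_id.
apply: bigmax_le => // i _.
(* The exponents [d - i] are pairwise distinct, so no two terms of the sum combine. *)
have -> : a i = mcoeff (d - (i : nat)%:Z) f.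
  rewrite mcoeff_laurent_sum (bigD1 i) //= eqxx mulr1n big1 ?addr0 // => j ji.
  rewrite (inj_eq (addrI d)) eqr_opp eqz_nat.
  by rewrite (inj_eq val_inj) (negbTE ji).
have [fi|fi] := boolP (d - (i : nat)%:Z \in msupp f).
  exact: (le_bigmax_seq 0 _ xpredT (fun k => v (mcoeff k f))).
by rewrite mcoeff_outdom // absval_0.
Qed.

Lemma laurent_sum_max_gt0 : f <> 0 -> 0 < G.
Proof.
move=> f0; rewrite lt_neqAle bigmax_ge_id andbT eq_sym.
apply/negP => /eqP G0; apply: f0; rewrite /f big1 // => i _.
have -> : a i = 0.
  apply/(absval_eq0 vP)/eqP.
  by rewrite eq_le (absval_ge0 vP) andbT -G0 le_bigmax.
by apply/malgP => k; rewrite mcoeffU mul0rn mcoeff0.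
Qed.

(** This is [t ^ (l - d) * f(t)]: the exponents of [f] run downwards from [d] to [d - l], hence the
    reversed coefficients. At [z] with [v z = 1] the monomial factor does not change the absolute
    value. *)
Let P : {poly F} := \poly_(j < l.+1) a (inord (l - j)).

Lemma laurent_eval_sum z : v z = 1 -> v (laurent_eval f z) = v P.[z].
Proof.
move=> z1; have z0 := absval_eq1_neq0 vP z1.
have -> : laurent_eval f z = z ^ (d - l%:Z) * P.[z].
  rewrite /laurent_eval /f raddf_sum horner_poly (reindex_inj rev_ord_inj) /=.
  rewrite mulr_sumr; apply: eq_bigr => i _.
  have il : (i <= l)%N by rewrite -ltnS.
  have -> : inord (l - i) = rev_ord i.
    by apply: val_inj; rewrite /= inordK ?subSS // ltnS leq_subr.
  rewrite mmapU /= subSS mulrCA exprnP -expfzDr //.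
  congr (_ * z ^ _); rewrite -subzn //; ring.
by rewrite (absvalM vP) absval_exprz1 // mul1r.
Qed.

Lemma laurent_sum_poly_coef_le i : v P`_i <= G.
Proof.
rewrite coef_poly; case: ifP => _; first exact: le_bigmax.
by rewrite absval_0 //; exact: bigmax_ge_id.
Qed.

Lemma laurent_sum_poly_coef_max : exists i, v P`_i = G.
Proof.
have [i _ Gi] := @eq_bigmax _ _ _ (0 : R) ord0 xpredT (v \o a) isT
  (fun i _ => absval_ge0 vP (a i)).
have il : (i <= l)%N by rewrite -ltnS.
exists (l - i)%N.
by rewrite coef_poly ltnS leq_subr subKn // inord_val /G Gi.
Qed.

End LaurentSum.

(** * Mahler measure and Gauss norm *)

Theorem proposition2p7 (R : realType) (p : nat) (p_prime : prime p)
  (C : padic_complex R p) (d : int) (l : nat) (a : 'I_l.+1 -> C)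
  (f : laurent C) (f_neq0 : f <> 0)
  (f_def : f = \sum_(i < l.+1) laurent_monomial (a i) (d - (i : nat)%:Z)) :
  [/\ cvg (log_mahler_mean (@Cp_abs R p C) f @ \oo),
      mahler_measure (@Cp_abs R p C) f
        = \big[Num.max/0]_(i < l.+1) Cp_abs (a i)
    & mahler_measure (@Cp_abs R p C) f = gauss_norm (@Cp_abs R p C) f].
Proof.
pose v := @Cp_abs R p C; pose G := \big[Num.max/0]_(i < l.+1) v (a i).
have vP : nonarch_absval v := completion_absval (Cp_completion C).
have p0 := prime_gt0 p_prime; have p1 := prime_gt1 p_prime.
have vp : v p%:R = p%:R^-1.
  by rewrite /v Cp_abs_nat padic_abs_nat // logn_prime // eqxx.
have pR : 0 < p%:R^-1 :> R by rewrite invr_gt0 ltr0n.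
have pR1 : p%:R^-1 < 1 :> R by rewrite invf_lt1 ?ltr0n // ltr1n.
(* The prime [p] has absolute value [p%:R^-1] and every other prime has 1, so [p%:R^-1] is a
   positive lower bound over all primes. *)
have vq q : prime q -> p%:R^-1 <= v q%:R.
  move=> q_pr; rewrite /v Cp_abs_nat padic_abs_nat ?prime_gt0 // logn_prime //.
  by case: eqP => _; rewrite ?expr1 // expr0 invr1 ltW.
have G0 : 0 < G by apply: (laurent_sum_max_gt0 vP (d := d)); rewrite -f_def.
have cvgG : log_mahler_mean v f @ \oo --> ln G.
  apply: (log_mahler_mean_cvg vP pR vq p0 _ _ _ G0
    (laurent_sum_poly_coef_le vP a) (laurent_sum_poly_coef_max vP a)).
  - by rewrite vp.
  - by move=> n; exact: Cp_unity_roots.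
  - move=> n z n0 zn.
    by rewrite f_def laurent_eval_sum // (absval_unity_root vP n0).
have MG : mahler_measure v f = G.
  by rewrite /mahler_measure (cvg_lim _ cvgG) // lnK.
split; first by apply/cvg_ex; exists (ln G).
  exact: MG.
by rewrite -/v MG f_def gauss_norm_laurent_sum.
Qed.
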